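(* Let $k\ge1$ and $r\ge0$ be integers, and let $\mathfrak C=\{\mathfrak c(s)\mid s\in\mathbb N^*\}$ be the concept class defined in the context. Any algorithm learning the class $\mathfrak C^k:=\{\prod_{i=1}^k\mathfrak c(s_i)\mid s_1,\dots,s_k\in\mathbb N^*\}$ from subset queries requires, in the worst case, at least $k^r$ queries to learn a concept $\prod_{i=1}^k\mathfrak c(s_i)$ whose sum of string lengths $\sum_{i=1}^k|s_i|$ is $r$. The same holds for any algorithm learning $\mathfrak C^k$ from equivalence queries. (Equivalently, writing $\#q_i=|s_i|$, the algorithm takes at least $k^{\sum_i\#q_i}$ subset, respectively equivalence, queries.)
   Context: $\mathbb N^*$ is the set of finite strings over the alphabet $\mathbb N$, $\lambda$ is the empty string, $|s|$ is the length of $s$, and $sa$ is the string $s$ followed by the letter $a\in\mathbb N$. For $s\in\mathbb N^*$ the concept $\mathfrak c(s)\subseteq\mathbb N^*\times\mathbb N$ is $\mathfrak c(s):=(\{s\}\times\mathbb N)\cup\mathfrak c_{sub}(s)$, where $\mathfrak c_{sub}(\lambda):=\emptyset$ and $\mathfrak c_{sub}(sa):=(\{s\}\times(\mathbb N\setminus\{a\}))\cup\mathfrak c_{sub}(s)$. For example, $\mathfrak c(12)=(\{12\}\times\mathbb N)\cup(\{1\}\times(\mathbb N\setminus\{2\}))\cup(\{\lambda\}\times(\mathbb N\setminus\{1\}))$ (where $12$ is the two-letter string). For a concept class $D$ (a set of subsets, called concepts, of some set) with unknown target $c^*\in D$: a subset query takes $c\in D$, and the oracle returns `true' if $c\subseteq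 c^*$ and otherwise some element of $c\setminus c^*$; an equivalence query takes $c\in D$, and the oracle returns `true' if $c=c^*$ and otherwise some element of $(c\setminus c^* )\cup(c^*\setminus c)$. Counterexamples are chosen arbitrarily (possibly adversarially) by the oracle. A learning algorithm for $D$ is a deterministic adaptive query strategy that, for every target $c^*\in D$ and every valid oracle behaviour, stops after finitely many queries and outputs $c^*$. ''Requires in the worst case at least $N$ queries to learn a concept with property $P$'' means: for every learning algorithm there are a target with property $P$ and a valid oracle behaviour for which the algorithm makes at least $N$ queries. *)

(* Defs.v *)
From mathcomp Require Import all_boot.
From mathcomp Require Import boolp classical_sets.

Set Implicit Arguments.
Unset Strict Implicit.
Unset Printing Implicit Defensive.

Local Open Scope classical_set_scope.

(* The answer 'true', or a counterexample. *)
Inductive reply (X : Type) := Yes | Counterexample of X.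
Arguments Yes {X}.

Inductive action (X : Type) := Ask of set X | Output of set X.

(* A query strategy sees the replies obtained so far, in chronological order;
   being deterministic, it can recover its own earlier queries from them. *)
Definition strategy (X : Type) := seq (reply X) -> action X.

(* The oracle may be adversarial: its reply depends on the whole past, so that
   repeated queries may be answered differently. *)
Definition oracle (X : Type) := seq (reply X) -> set X -> reply X.

(* [protocol t c a]: [a] is an admissible reply to query [c] for target [t]. *)
Definition protocol (X : Type) := set X -> set X -> reply X -> Prop.

Definition subset_query (X : Type) : protocol X := fun t c a =>
  match a with
  | Yes => c `<=` t
  | Counterexample x => (c `\` t) x
  end.

Definition equivalence_query (X : Type) : protocol X := fun t c a =>
  match a with
  | Yes => c = t
  | Counterexample x => ((c `\` t) `|` (t `\` c)) x
  end.

Definition valid_oracle (X : Type) (Q : protocol X) (D : set (set X))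
    (t : set X) (O : oracle X) : Prop :=
  forall h c, D c -> Q t c (O h c).

Fixpoint history (X : Type) (A : strategy X) (O : oracle X) (n : nat)
    : seq (reply X) :=
  if n is m.+1 then
    let h := history A O m in
    match A h with
    | Ask c => rcons h (O h c)
    | Output _ => h
    end
  else [::].

(* The history stops growing once an output is produced, so the size condition
   says that exactly [n] queries were made before the output. *)
Definition outputs_after (X : Type) (A : strategy X) (O : oracle X) (n : nat)
    (t : set X) : Prop :=
  size (history A O n) = n /\ A (history A O n) = Output t.

(* Queries have to lie in [D], but only in histories that can actually occur. *)
Definition learns (X : Type) (Q : protocol X) (D : set (set X))
    (A : strategy X) : Prop :=
  forall t O, D t -> valid_oracle Q D t O ->
    (forall n c, A (history A O n) = Ask c -> D c) /\
    (exists n, outputs_after A O n t).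

Definition requires_queries (X : Type) (Q : protocol X) (D P : set (set X))
    (N : nat) : Prop :=
  forall A, learns Q D A ->
    exists t O n, [/\ D t, P t, valid_oracle Q D t O,
                      outputs_after A O n t & N <= n].

(* [csub_from p s] is the contribution to csub (p ++ s) of the letters of [s];
   the recursion on the last letter is [csub_nil] and [csub_rcons]. *)
Fixpoint csub_from (p s : seq nat) : set (seq nat * nat) :=
  if s is a :: s' then
    ([set p] `*` ~` [set a]) `|` csub_from (rcons p a) s'
  else set0.

Definition csub (s : seq nat) : set (seq nat * nat) := csub_from [::] s.

Definition concept (s : seq nat) : set (seq nat * nat) :=
  ([set s] `*` [set: nat]) `|` csub s.

Lemma csub_nil : csub [::] = set0.
Proof. by []. Qed.

Lemma csub_rcons (s : seq nat) (a : nat) :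
  csub (rcons s a) = ([set s] `*` ~` [set a]) `|` csub s.
Proof.
suff H p : csub_from p (rcons s a) =
    ([set p ++ s] `*` ~` [set a]) `|` csub_from p s by exact: H.
elim: s p => [|b s IHs] p /=; first by rewrite cats0.
by rewrite IHs cat_rcons setUCA.
Qed.

Definition prod_concept (k : nat) (s : 'I_k -> seq nat)
    : set ('I_k -> seq nat * nat) :=
  [set x | forall i, concept (s i) (x i)].

Definition prod_class (k : nat) : set (set ('I_k -> seq nat * nat)) :=
  range (@prod_concept k).

Definition total_length (k r : nat) : set (set ('I_k -> seq nat * nat)) :=
  [set c | exists2 s : 'I_k -> seq nat,
             c = prod_concept s & \sum_(i < k) size (s i) = r].

(* Main.v *)
(* The concepts of the class are pairwise incomparable, so an oracle answering
   every query [prod_concept s] with a counterexample from the query itself is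
   valid for both protocols as long as [s] is not the target.  The adversary
   repeats an old counterexample if [s] is already refuted, and otherwise answers
   [(s_i, a)_i] with a fresh letter [a].  A target [t] survives this only if
   [s_i a] is a prefix of [t_i] for some [i], or [s] is not componentwise a
   prefix of [t].  Hence the minimal surviving targets form a tree in which a
   query replaces at most one node [s] by its [k] extensions, each by one letter
   [a] in one component.  Weighting a node of total length [l <= r] by
   [k ^ (r - l)] and longer ones by 0, a query lowers the total weight, initially
   [k ^ r], by at most one.  So after fewer than [k ^ r] queries some target of
   total length at most [r] survives, and fresh extensions of it survive too. *)

Require Import Defs.
From mathcomp Require Import all_boot.
From mathcomp Require Import boolp classical_sets.
From mathcomp Require Import zify.

Set Implicit Arguments.
Unset Strict Implicit.
Unset Printing Implicit Defensive.

Local Open Scope classical_set_scope.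

(** * Membership in concepts and prefixes *)

Lemma csub_size (t p : seq nat) (b : nat) : csub t (p, b) -> size p < size t.
Proof.
elim/last_ind: t => [|t a IHt] //; rewrite csub_rcons size_rcons.
by case=> [[/= -> _]|/IHt /ltnW].
Qed.

Lemma concept_prefix (t p : seq nat) (b : nat) : concept t (p, b) -> prefix p t.
Proof.
case=> [[/= -> _]|]; first exact: prefix_refl.
elim/last_ind: t => [|t a IHt] //; rewrite csub_rcons.
case=> [[/= -> _]|/IHt pt]; first exact: prefix_rcons.
exact: prefix_trans pt (prefix_rcons _ _).
Qed.

(** If [p] is a proper prefix of [t], the letter following it in [t] is the only one left out. For
    any other [p], [csub t] has no pair [(p, b)] at all, so the default 0 is harmless. *)
Lemma csub_nth (t p : seq nat) : ~ csub t (p, nth 0 t (size p)).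
Proof.
elim/last_ind: t => [|t a IHt] //; rewrite csub_rcons nth_rcons.
case=> [[/= -> ]|tp]; first by rewrite ltnn eqxx; apply.
by have pt := csub_size tp; move: tp; rewrite pt => /IHt.
Qed.

Lemma concept_self (s : seq nat) (b : nat) : concept s (s, b).
Proof. by left. Qed.

Lemma concept_rconsN (s : seq nat) (a : nat) : ~ concept (rcons s a) (s, a).
Proof.
case=> [[/= /(congr1 size) + _]|]; first by rewrite size_rcons => /n_Sn.
rewrite csub_rcons => -[[_ /=]|/csub_size]; first exact.
by rewrite ltnn.
Qed.

(** Appending [a] to [s] only removes [(s, a)] and adds pairs with first entry [rcons s a]; a pair
    without [a] sees neither change. *)
Lemma concept_rcons_fresh (s p : seq nat) (a b : nat) :
  a \notin p -> b != a -> concept (rcons s a) (p, b) <-> concept s (p, b).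
Proof.
move=> ap /eqP ba; rewrite /concept csub_rcons; split.
  case=> [[/= ps _]|[[/= ps _]|]]; [|by left|by right].
  by rewrite ps mem_rcons mem_head in ap.
by case=> [[/= ps _]|]; right; [left|right].
Qed.

Lemma prod_concept_inj (k : nat) (s t : 'I_k -> seq nat) :
  prod_concept s `<=` prod_concept t -> s = t.
Proof.
move=> st; apply/funext => i.
(* The test point pairs each [s j] with the letter that would follow it in [t j]. This bars it from
   [csub (t j)], leaving only [s j = t j]. *)
have /st/(_ i)[[]//|/csub_nth//] :
  prod_concept s (fun j => (s j, nth 0 (t j) (size (s j)))).
by move=> j; apply: concept_self.
Qed.

Lemma prod_class_ffun (k : nat) (c : set ('I_k -> seq nat * nat)) :
  prod_class c -> exists s : {ffun 'I_k -> seq nat}, prod_concept s = c.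
Proof.
case=> s _ <-; exists (finfun s); congr prod_concept.
by apply/funext => i; rewrite ffunE.
Qed.

(** * Refuted targets and fresh letters *)

Definition refutes (X : Type) (c : set X) (a : reply X) : bool :=
  if a is Counterexample x then `[< c x >] else false.

(** A point given as counterexample to a subset query lies outside the target, so every concept
    containing it is excluded. *)
Definition dead (k : nat) (h : seq (reply ('I_k -> seq nat * nat)))
    (s : {ffun 'I_k -> seq nat}) : bool :=
  has (refutes (prod_concept s)) h.

Definition below (k n : nat) (a : reply ('I_k -> seq nat * nat)) : bool :=
  if a is Counterexample x
  then [forall i, all (ltn^~ n) (x i).1 && ((x i).2 < n)] else true.

Lemma below_leq (k m n : nat) (a : reply ('I_k -> seq nat * nat)) :
  m <= n -> below m a -> below n a.
Proof.
case: a => //= x mn /forallP xm; apply/forallP => i.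
have /andP[xi1 xi2] := xm i; rewrite (leq_trans xi2 mn) andbT.
by apply: sub_all xi1 => l lm; apply: leq_trans lm mn.
Qed.

Lemma ex_below (k : nat) (a : reply ('I_k -> seq nat * nat)) :
  exists n, below n a.
Proof.
case: a => [|x]; first by exists 0.
pose b i := maxn (\max_(l <- (x i).1) l) (x i).2.
exists (\max_i b i).+1; apply/forallP => i.
have bi : b i <= \max_j b j by exact: leq_bigmax.
apply/andP; split; last by rewrite ltnS (leq_trans _ bi) ?leq_maxr.
apply/allP => l lx /=; rewrite ltnS (leq_trans _ bi) // leq_max.
by rewrite (leq_bigmax_seq l).
Qed.

Lemma ex_fresh (k : nat) (h : seq (reply ('I_k -> seq nat * nat))) :
  exists n, all (below n) h.
Proof.
elim: h => [|a h [n hn]]; first by exists 0.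
have [m am] := ex_below a; exists (maxn m n) => /=.
rewrite (below_leq (leq_maxl _ _) am) /=.
by apply: sub_all hn => b; apply: below_leq (leq_maxr _ _).
Qed.

Definition fresh (k : nat) (h : seq (reply ('I_k -> seq nat * nat))) : nat :=
  ex_minn (ex_fresh h).

Lemma freshP (k : nat) (h : seq (reply ('I_k -> seq nat * nat))) :
  all (below (fresh h)) h.
Proof. by rewrite /fresh; case: ex_minnP. Qed.

Definition extend (k : nat) (s : {ffun 'I_k -> seq nat}) (i : 'I_k) (a : nat) :
    {ffun 'I_k -> seq nat} :=
  [ffun j => if j == i then rcons (s j) a else s j].

(** Past counterexamples do not mention the letter [n], hence cannot tell [s] from its extension by
    [n]. *)
Lemma dead_extend (k : nat) (h : seq (reply ('I_k -> seq nat * nat)))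
    (s : {ffun 'I_k -> seq nat}) (i : 'I_k) (n : nat) :
  all (below n) h -> dead h (extend s i n) = dead h s.
Proof.
rewrite /dead; elim: h => //= a h IHh /andP[an /IHh ->]; congr (_ || _).
case: a an => //= x /forallP xn; apply: asbool_equiv_eq.
have E j : concept (extend s i n j) (x j) <-> concept (s j) (x j).
  rewrite ffunE; case: eqP => // _.
  have := xn j; case: (x j) => p b /= /andP[/allP pn bn].
  apply: concept_rcons_fresh; last by rewrite neq_ltn bn.
  by apply/negP => /pn /=; rewrite ltnn.
by split=> sx j; apply/E.
Qed.

Definition level (k : nat) (s : {ffun 'I_k -> seq nat}) : nat :=
  \sum_(i < k) size (s i).

Lemma level_extend (k : nat) (s : {ffun 'I_k -> seq nat}) (i : 'I_k) (a : nat) :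
  level (extend s i a) = (level s).+1.
Proof.
rewrite /level (bigD1 i) //= [in RHS](bigD1 i) //= ffunE eqxx size_rcons.
rewrite addSn; congr (_ + _).+1; apply: eq_bigr => j /negbTE ji.
by rewrite ffunE ji.
Qed.

(** The same letter [fresh h] can be appended [d] times to one component, as freshness concerns [h]
    only. *)
Lemma alive_extend (k : nat) (hk : 0 < k)
    (h : seq (reply ('I_k -> seq nat * nat))) (s : {ffun 'I_k -> seq nat})
    (d : nat) :
  ~~ dead h s -> exists2 t, ~~ dead h t & level t = level s + d.
Proof.
move=> sh; elim: d => [|d [t th tl]]; first by exists s; rewrite ?addn0.
exists (extend t (Ordinal hk) (fresh h)); first by rewrite dead_extend ?freshP.
by rewrite level_extend tl addnS.
Qed.

(** * The adversary *)

(* Queries outside the class are answered [Yes], so that they kill nothing. *)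
Definition adversary (k : nat) : oracle ('I_k -> seq nat * nat) := fun h c =>
  if `[< prod_class c >] then
    if has (refutes c) h then nth Yes h (find (refutes c) h)
    else
      let s := xget [ffun=> [::]]
                 [set s : {ffun 'I_k -> seq nat} | prod_concept s = c] in
      Counterexample (fun i => (s i, fresh h))
  else Yes.

Variant adversary_spec (k : nat) (h : seq (reply ('I_k -> seq nat * nat)))
    (c : set ('I_k -> seq nat * nat)) : reply ('I_k -> seq nat * nat) -> Prop :=
| AdversaryOut of ~ prod_class c : adversary_spec h c Yes
| AdversaryRepeat a of refutes c a &
    (forall d, refutes d a -> has (refutes d) h) : adversary_spec h c a
| AdversaryNew (s : {ffun 'I_k -> seq nat}) of c = prod_concept s &
    ~~ dead h s :
    adversary_spec h c (Counterexample (fun i => (s i, fresh h))).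

Lemma adversaryP (k : nat) (h : seq (reply ('I_k -> seq nat * nat)))
    (c : set ('I_k -> seq nat * nat)) :
  adversary_spec h c (adversary h c).
Proof.
rewrite /adversary; case: asboolP => [cD|]; last exact: AdversaryOut.
case: ifPn => [ch|ch].
  apply: AdversaryRepeat; first exact: nth_find.
  move=> d da; apply/(has_nthP Yes).
  by exists (find (refutes c) h); rewrite // -has_find.
have := xgetPex [ffun=> [::]] (prod_class_ffun cD).
by move: (xget _ _) => s /= sc; apply: AdversaryNew; rewrite // /dead sc.
Qed.

(** * The frontier of minimal live targets and its weight *)

(* By minimality, a live [s] outside [M] is below no element of [M], so the new
   counterexample to [s] kills nothing in [M]. *)
Definition frontier (k : nat) (h : seq (reply ('I_k -> seq nat * nat)))
    (M : seq {ffun 'I_k -> seq nat}) : Prop :=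
  [/\ uniq M, forall m, m \in M -> ~~ dead h m &
      forall m u : {ffun 'I_k -> seq nat}, m \in M ->
        (forall i, prefix (u i) (m i)) -> u != m -> dead h u].

Definition weight (k r : nat) (m : {ffun 'I_k -> seq nat}) : nat :=
  if level m <= r then k ^ (r - level m) else 0.

(** Below level [r] the [k] extensions share the weight of [s] without loss; the extra 1 is spent
    only at level [r], where weight 1 drops to 0. *)
Lemma weight_extend (k r : nat) (s : {ffun 'I_k -> seq nat}) (a : nat) :
  weight r s <= (\sum_(i < k) weight r (extend s i a)).+1.
Proof.
under eq_bigr => i _ do rewrite /weight level_extend.
rewrite sum_nat_const card_ord /weight.
case: (ltngtP (level s) r) => // [sr|->]; last by rewrite subnn.
by rewrite -expnS -subSn // subSS leqnSn.
Qed.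

Lemma frontier_equiv (k : nat) (h h' : seq (reply ('I_k -> seq nat * nat)))
    (M : seq {ffun 'I_k -> seq nat}) :
  dead h =1 dead h' -> frontier h M -> frontier h' M.
Proof.
by move=> hh' [MU MA Mm]; split=> // [m /MA|m u mM um umn];
  rewrite -hh' //; apply: Mm um umn.
Qed.

Lemma prefix_rconsE (p s : seq nat) (a : nat) :
  prefix p (rcons s a) -> p != rcons s a -> prefix p s.
Proof.
case/prefixP=> q; case/lastP: q => [|q b].
  by rewrite cats0 => ->; rewrite eqxx.
by rewrite -rcons_cat => /rcons_inj[-> _] _; apply: prefix_prefix.
Qed.

(** [M] changes only on a new counterexample to a member [s], which then gives way to its [k]
    extensions by the fresh letter. *)
Lemma frontier_step (k r : nat) (h : seq (reply ('I_k -> seq nat * nat)))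
    (c : set ('I_k -> seq nat * nat)) (M : seq {ffun 'I_k -> seq nat}) :
  frontier h M -> exists2 M', frontier (rcons h (adversary h c)) M' &
    \sum_(m <- M) weight r m <= (\sum_(m <- M') weight r m).+1.
Proof.
move=> FM; case: adversaryP => [_|a _ ah|s _ sh].
- exists M; last exact: leqnSn.
  by apply: frontier_equiv FM => u; rewrite /dead has_rcons.
- exists M; last exact: leqnSn.
  apply: frontier_equiv FM => u; rewrite /dead has_rcons.
  by case: (boolP (refutes _ a)) => // /ah ->.
set x := Counterexample _; set h' := rcons h x.
have deadW u : dead h u -> dead h' u.
  by rewrite /dead has_rcons => ->; rewrite orbT.
have ds : dead h' s.
  rewrite /dead has_rcons /=; apply/orP; left; apply/asboolP => i.
  exact: concept_self.
case: FM => MU MA Mm.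
have sMin m : m \in M -> (forall i, prefix (s i) (m i)) -> m = s.
  move=> mM sm; apply/eqP/negPn; apply: contra sh => ms.
  by apply: Mm mM sm _; rewrite eq_sym.
have kill m : m \in M -> m != s -> ~~ dead h' m.
  move=> mM ms; rewrite /dead has_rcons negb_or MA // andbT /=.
  apply/asboolP => xm; move/negP: ms; apply; apply/eqP.
  by apply: sMin => // i; apply: concept_prefix (xm i).
have [sM|sM] := boolP (s \in M); last first.
  exists M; last exact: leqnSn.
  split=> // [m mM|m u mM um umn]; last exact/deadW/(Mm m).
  by apply: kill => //; apply: contraNneq sM => <-.
set a := fresh h.
exists ([seq extend s i a | i <- enum 'I_k] ++ rem s M); last first.
  rewrite (perm_big _ (perm_to_rem sM)) big_cons big_cat big_map big_enum /=.
  by rewrite -addSn leq_add2r weight_extend.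
have sext i j : prefix (s j) (extend s i a j).
  by rewrite ffunE; case: eqP => _; [exact: prefix_rcons|exact: prefix_refl].
split.
- rewrite cat_uniq rem_uniq // andbT map_inj_uniq ?enum_uniq /=; last first.
    move=> i j /ffunP/(_ i); rewrite !ffunE eqxx; case: eqP => // _.
    by move/(congr1 size); rewrite size_rcons => /esym/n_Sn.
  apply/hasPn => m; rewrite mem_rem_uniq // => /andP[/= ms mM].
  apply/negP => /mapP[i _ me]; move/eqP: ms; apply; apply: sMin => // j.
  by rewrite me.
- move=> m; rewrite mem_cat => /orP[/mapP[i _ ->]|]; last first.
    by rewrite mem_rem_uniq // => /andP[/= ms mM]; apply: kill.
  rewrite /dead has_rcons negb_or; apply/andP; split; last first.
    by rewrite -/(dead _ _) dead_extend ?freshP.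
  (* Component [i] of the new counterexample is [(s i, a)], the very pair lost when [a] is appended
     to [s i]. *)
  apply/asboolP => /(_ i); rewrite ffunE eqxx; exact: concept_rconsN.
move=> m u; rewrite mem_cat => /orP[/mapP[i _ ->]|]; last first.
  by rewrite mem_rem_uniq // => /andP[_ mM] um umn; apply/deadW/(Mm m).
move=> us un; have uj j : j != i -> prefix (u j) (s j).
  by move=> /negbTE ji; have := us j; rewrite ffunE ji.
have ui : prefix (u i) (rcons (s i) a) by have := us i; rewrite ffunE eqxx.
(* If [u] uses the fresh letter, stripping it gives some [v] strictly below [s], dead by minimality,
   and [u] is as dead as [v]. Otherwise [u] is below [s] or equal to it. *)
have [ui'|ui'] := eqVneq (u i) (rcons (s i) a).
  pose v := [ffun j => if j == i then s i else u j].
  have uv : u = extend v i a.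
    by apply/ffunP => j; rewrite !ffunE; case: eqP => // ->.
  apply: deadW; rewrite uv dead_extend ?freshP //.
  apply: (Mm s) => // [j|].
    by rewrite ffunE; case: eqVneq => [->|/uj//]; exact: prefix_refl.
  by apply: contraNneq un => vs; rewrite uv vs.
have {}us j : prefix (u j) (s j).
  by have [->|/uj//] := eqVneq j i; apply: prefix_rconsE ui ui'.
by have [->//|us'] := eqVneq u s; apply/deadW/(Mm s).
Qed.

(** * From surviving weight to the lower bound *)

Lemma frontier_history (k r n : nat) (A : strategy ('I_k -> seq nat * nat)) :
  exists2 M, frontier (history A (@adversary k) n) M &
    k ^ r <= \sum_(m <- M) weight r m + n.
Proof.
elim: n => [|n [M FM Mw]] /=.
  exists [:: [ffun=> [::]]].
    split=> // m u; rewrite inE => /eqP -> u0 /eqP; case.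
    by apply/ffunP => i; have := u0 i; rewrite ffunE prefixs0 => /eqP.
  rewrite big_seq1 /weight /level big1 ?subn0 ?addn0 // => i _.
  by rewrite ffunE.
case: (A _) => c; last by exists M => //; lia.
have [M' FM' MM'] := frontier_step r c FM.
by exists M' => //; lia.
Qed.

(** Positive weight remains, so [M] has a member of level at most [r]; fresh letters raise it to
    level exactly [r]. *)
Lemma alive_history (k r n : nat) (hk : 0 < k)
    (A : strategy ('I_k -> seq nat * nat)) :
  n < k ^ r ->
  exists2 s, ~~ dead (history A (@adversary k) n) s & level s = r.
Proof.
have [M [_ MA _] Mw] := frontier_history r n A => nr.
have [m mM mr] : exists2 m, m \in M & level m <= r.
  apply/hasP/negPn; rewrite -all_predC; apply/negP => /allP Mr.
  move: Mw; rewrite big_seq big1 => [|m /Mr /= /negbTE mr]; first lia.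
  by rewrite /weight mr.
have [s sh sr] := alive_extend hk (r - level m) (MA m mM).
by exists s; rewrite // sr subnKC.
Qed.

(** The adversary commits to no target. This oracle copies it while its replies are admissible for
    [t] and otherwise answers truthfully. *)
Definition repaired (k : nat) (t : set ('I_k -> seq nat * nat)) :
    oracle ('I_k -> seq nat * nat) := fun h c =>
  if `[< prod_class c -> subset_query t c (adversary h c) >]
  then adversary h c
  else if `[< c `<=` t >] then Yes
  else Counterexample (xget (fun=> ([::], 0)) (c `\` t)).

Lemma repaired_valid (k : nat) (t : set ('I_k -> seq nat * nat)) :
  valid_oracle (@subset_query _) (@prod_class k) t (repaired t).
Proof.
move=> h c cD; rewrite /repaired; case: asboolP => [|_]; first exact.
by case: asboolP => // /nonsubset/xgetPex; apply.
Qed.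

Lemma dead_history (k i j : nat) (A : strategy ('I_k -> seq nat * nat))
    (O : oracle ('I_k -> seq nat * nat)) (s : {ffun 'I_k -> seq nat}) :
  i <= j -> dead (history A O i) s -> dead (history A O j) s.
Proof.
move=> /subnKC <- sd; elim: (j - i) => [|d IHd]; first by rewrite addn0.
rewrite addnS /=; case: (A _) => // c.
by rewrite /dead has_rcons -/(dead _ _) IHd orbT.
Qed.

(** Each counterexample of the adversary lies in the query, and it lies outside a target that is
    still live, so no reply needs repair. *)
Lemma history_repaired (k n : nat) (A : strategy ('I_k -> seq nat * nat))
    (s : {ffun 'I_k -> seq nat}) :
  ~~ dead (history A (@adversary k) n) s ->
  forall j, j <= n ->
    history A (repaired (prod_concept s)) j = history A (@adversary k) j.
Proof.
move=> sn; elim=> [//|j IHj] jn /=; rewrite IHj ?(ltnW jn) //.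
have := contra (dead_history jn) sn; rewrite /=.
case: (A _) => // c; rewrite /dead has_rcons negb_or => /andP[sc _].
congr rcons; rewrite /repaired asboolT // => cD.
case: adversaryP sc => // [[//|x] /asboolP cx _ /asboolP sx|u -> _ /asboolP sx];
  split=> //.
by move=> i; apply: concept_self.
Qed.

Lemma history_output (X : Type) (A : strategy X) (O : oracle X) (i j : nat)
    (t : set X) :
  i <= j -> A (history A O i) = Output t -> history A O j = history A O i.
Proof.
move=> /subnKC <- At; elim: (j - i) => [|d IHd]; first by rewrite addn0.
by rewrite addnS /= IHd At.
Qed.

Lemma output_unique (X : Type) (A : strategy X) (O : oracle X) (i j : nat)
    (t u : set X) :
  A (history A O i) = Output t -> A (history A O j) = Output u -> t = u.
Proof.
wlog ij : i j t u / i <= j => [H At Au|At].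
  by case: (leqP i j) => [/H|/ltnW/H]; [apply|move=> E; apply/esym/E].
by rewrite (history_output ij At) At => -[].
Qed.

Lemma requires_queries_prod (k r : nat) (Q : protocol ('I_k -> seq nat * nat)) :
  1 <= k ->
  (forall t c a, prod_class t -> prod_class c ->
     subset_query t c a -> Q t c a) ->
  requires_queries Q (@prod_class k) (@total_length k r) (k ^ r).
Proof.
move=> hk QP A AL; have kr : 0 < k ^ r by rewrite expn_gt0 hk.
have [s sh sr] := alive_history hk A (etrans (ltn_predL _) kr).
move: sh; set n := (k ^ r).-1 => sh.
have D (u : {ffun 'I_k -> seq nat}) : prod_class (prod_concept u).
  by exists u.
have V (u : {ffun 'I_k -> seq nat}) :
    valid_oracle Q (@prod_class k) (prod_concept u) (repaired (prod_concept u)).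
  by move=> h c cD; apply: QP => //; apply: repaired_valid.
have [_ [N [Ns NA]]] := AL _ _ (D s) (V s).
exists (prod_concept s), (repaired (prod_concept s)), N; split=> //.
  by exists s.
rewrite leqNgt; apply/negP => Nr; have Nn : N <= n by rewrite /n; lia.
(* Premature output would be wrong for another target that is still live. *)
pose u := extend s (Ordinal hk) (fresh (history A (@adversary k) n)).
have uh : ~~ dead (history A (@adversary k) n) u.
  by rewrite dead_extend ?freshP.
have [_ [N' [_ NA']]] := AL _ _ (D u) (V u).
(* Up to [n] replies both repaired oracles agree with the adversary, hence with each other. *)
rewrite (history_repaired sh) // -(history_repaired uh) // in NA.
have := output_unique NA NA' => su.
have : level u = level s.
  by apply: eq_bigr => i _; rewrite (prod_concept_inj (s := s) (t := u)) // su.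
by rewrite level_extend => /esym/n_Sn.
Qed.

Theorem theorem1 (k r : nat) (hk : 1 <= k) :
  requires_queries (@subset_query _) (@prod_class k) (@total_length k r)
    (k ^ r) /\
  requires_queries (@equivalence_query _) (@prod_class k) (@total_length k r)
    (k ^ r).
Proof.
split; apply: requires_queries_prod => // t c [|x] [u _ <-] [s _ <-] /=.
  (* For equivalence queries, incomparability turns the inclusion behind a [Yes] into equality. *)
  by move/prod_concept_inj->.
by left.
Qed.
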